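(* Let $G=(V,E)$ be a split graph and let $u\notin V$. Then the algorithm ACCN, with primary instance $G$ and secondary instance $G\vee u$, returns $\omega(G\vee u)$.
   Context: All graphs are finite (with non-empty vertex set), simple, undirected and loop-free. A split graph is a graph whose vertex set can be partitioned into a clique and an independent set. $\omega(H)$ is the clique number of $H$, i.e. the largest size of a set of pairwise adjacent vertices. For $u\notin V$, $G\vee u$ is the graph with vertex set $W=V\cup\{u\}$ whose edges are the edges of $G$ together with all $\{u,x\}$, $x\in V$. In $G\vee u$, $C(x)=N(x)\cup\{x\}$ is the closed neighbourhood of $x$. For $A\subset W$ and $z\in A$, $d_z(A)$ is the degree of $z$ in the subgraph of $G\vee u$ induced by $A$. Algorithm ACCN. Input: the vertex set and the adjacency matrix of the primary instance $G$. Phase 1: construct the vertex set and the adjacency matrix of the secondary instance $G\vee u$. Phase 2: for each $y\in W$: put $A=C(y)$; for each $z\in A$ compute $d_z(A)$; compute the largest $k$ such that there are at least $k$ vertices $z\in A$ with $d_z(A)\ge k$; set $c(y{:}u)=k+1$. Phase 3: for each $y\in W$ set $c^*(y{:}u)=c(y{:}u)$. Then, for each $y\in W$ with $y\ne u$: compute the largest $p$ such that there are at least $p$ vertices $z\in C(y)$, including $y$ and $u$ (i.e. $y$ and $u$ are among these vertices), such that $p\le c^*(z{:}u)$; set $c^*(y{:}u)=p$. Finally compute the largest $p$ such that there are at least $p$ vertices $z\in W$, including $u$, such that $p\le c^*(z{:}u)$; set $c^*(u{:}u)=p$ and $c^*(G\vee u)=c^*(u{:}u)$. Return $c^*(G\vee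 u)$. *)

(* Defs.v *)
From mathcomp Require Import all_boot.

Set Implicit Arguments.
Unset Strict Implicit.
Unset Printing Implicit Defensive.

Record graph := Graph {
  vertex :> finType;
  adj : rel vertex;
  adj_sym : symmetric adj;
  adj_irrefl : irreflexive adj;
  vertex_gt0 : 0 < #|{: vertex}|
}.

Definition clique (H : graph) (A : {set H}) : bool :=
  [forall x in A, forall y in A, (x != y) ==> adj x y].

Definition independent (H : graph) (A : {set H}) : bool :=
  [forall x in A, forall y in A, ~~ adj x y].

Definition split_graph (H : graph) : Prop :=
  exists K I : {set H},
    [/\ K :|: I = [set: H], [disjoint K & I], clique K & independent I].

Definition omega (H : graph) : nat := \max_(A : {set H} | clique A) #|A|.

Definition closed_nbhd (H : graph) (x : H) : {set H} := x |: [set z | adj x z].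

Definition deg_in (H : graph) (A : {set H}) (z : H) : nat :=
  #|[set x in A | adj z x]|.

(* The graph G \/ u: its vertex type is [option G], where [None] plays the     *)
(* part of the new vertex u.                                                  *)
Section Join.
Variable G : graph.

Definition join_adj : rel (option G) := fun a b =>
  match a, b with
  | Some x, Some y => adj x y
  | None, None => false
  | _, _ => true
  end.

Lemma join_adj_sym : symmetric join_adj.
Proof. by move=> [x|] [y|] //=; rewrite adj_sym. Qed.

Lemma join_adj_irrefl : irreflexive join_adj.
Proof. by move=> [x|] //=; rewrite adj_irrefl. Qed.

Lemma join_vertex_gt0 : 0 < #|{: option G}|.
Proof. by rewrite card_option. Qed.

Definition join_vertex : graph :=
  Graph join_adj_sym join_adj_irrefl join_vertex_gt0.

Definition apex : join_vertex := None.

End Join.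

(* In the two maxima below the bound #|A| on the range loses nothing, since    *)
(* at least k elements of A are required; the value 0 always qualifies.       *)
Definition largest_deg (H : graph) (A : {set H}) : nat :=
  \max_(k < #|A|.+1 | k <= #|[set z in A | k <= deg_in A z]|) k.

(* Largest p such that at least p vertices z of A, those of B being among     *)
(* them, satisfy p <= c z; it is used with B a subset of A.                   *)
Definition largest_incl (H : graph) (A B : {set H}) (c : H -> nat) : nat :=
  \max_(p < #|A|.+1 | (B \subset [set z in A | p <= c z])
                      && (p <= #|[set z in A | p <= c z]|)) p.

Section ACCN.
Variable G : graph.
Local Notation W := (join_vertex G).
Local Notation u := (apex G).

Definition accn_phase2 (y : W) : nat := (largest_deg (closed_nbhd y)).+1.

Definition accn_update (c : W -> nat) (y : W) : W -> nat :=
  fun z => if z == y then largest_incl (closed_nbhd y) [set y; u] c else c z.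

(* The loop of Phase 3 works in place: later vertices see the values already  *)
(* updated. The list s is the order in which the vertices of W are visited.   *)
Definition accn_phase3 (s : seq W) : W -> nat :=
  foldl accn_update accn_phase2 [seq y <- s | y != u].

Definition ACCN (s : seq W) : nat :=
  largest_incl [set: W] [set u] (accn_phase3 s).

End ACCN.

(* Main.v *)
Require Import Defs.
From mathcomp Require Import all_boot.

(** Both inequalities come from bounds on the values that the algorithm
    attaches to vertices, each preserved by a single update of Phase 3.

    Lower bound: adding the apex to a clique of the join
    gives a clique, so it suffices to bound cliques [K] through the apex. Each
    [y] in [K] has [K] inside its closed neighbourhood, where all members of [K]
    have degree at least [#|K|.-1]; hence Phase 2 gives [y] a value at least
    [#|K|]. The members of [K] then witness, for one another, that this
    persists through every update of Phase 3 ([accn_phase3_ge]) and through the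
    final maximum.

    Upper bound, where splitness enters: updates only lower values, and Phase 2
    never exceeds the size of the closed neighbourhood ([accn_phase2_le]). For
    a vertex of the independent part that neighbourhood is a clique, so its
    value is at most [omega]. Vertices of value greater than [omega] thus all
    lie in the clique formed by the clique part and the apex, and there are at
    most [omega] of them, too few to make the final maximum exceed [omega]. *)

Lemma cliqueP (H : graph) (A : {set H}) :
  reflect {in A &, forall x y, x != y -> adj x y} (clique A).
Proof.
apply: (iffP idP) => [cA x y Ax Ay xy | cA].
  by move/forall_inP/(_ x Ax)/forall_inP/(_ y Ay)/implyP: cA; apply.
apply/forall_inP => x Ax; apply/forall_inP => y Ay; apply/implyP.
exact: cA.
Qed.

Lemma clique_le_omega (H : graph) (A : {set H}) : clique A -> #|A| <= omega H.
Proof. by move=> cA; apply: (bigmax_sup A). Qed.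

Lemma mem_closed_nbhd (H : graph) (x : H) : x \in closed_nbhd x.
Proof. exact: setU11. Qed.

Lemma clique_sub_closed_nbhd (H : graph) (K : {set H}) (y : H) :
  clique K -> y \in K -> K \subset closed_nbhd y.
Proof.
move=> /cliqueP cK Ky; apply/subsetP => z Kz; rewrite !inE.
by case: eqVneq => //= zy; apply: cK; rewrite // eq_sym.
Qed.

Lemma clique_apex (G : graph) (K : {set join_vertex G}) :
  clique K -> clique (apex G |: K).
Proof.
move=> /cliqueP cK; apply/cliqueP => -[x|] [y|] //.
by rewrite !inE /=; apply: cK.
Qed.

Lemma deg_in_clique (H : graph) (K A : {set H}) (z : H) :
  clique K -> K \subset A -> z \in K -> #|K|.-1 <= deg_in A z.
Proof.
move=> /cliqueP cK /subsetP KA Kz.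
rewrite (cardsD1 z K) Kz /=; apply/subset_leq_card/subsetP => x.
by rewrite !inE => /andP[xz Kx]; rewrite KA // cK // eq_sym.
Qed.

Lemma largest_deg_clique (H : graph) (K A : {set H}) :
  clique K -> K \subset A -> #|K|.-1 <= largest_deg A.
Proof.
move=> cK KA; have leKA := subset_leq_card KA.
have ltKA : #|K|.-1 < #|A|.+1 by rewrite ltnS (leq_trans (leq_pred _)).
apply: (bigmax_sup (Ordinal ltKA)) => //=.
apply: leq_trans (leq_pred _) _; apply/subset_leq_card/subsetP => z Kz.
by rewrite inE (subsetP KA) // (deg_in_clique _ K).
Qed.

(** There are no loops, so every vertex of [A] has degree less than [#|A|] in
    [A], and a positive [k] counted by the maximum is at most one such degree. *)
Lemma largest_deg_lt (H : graph) (A : {set H}) :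
  0 < #|A| -> largest_deg A < #|A|.
Proof.
move=> A_gt0; rewrite -(prednK A_gt0) ltnS; apply/bigmax_leqP => -[[|k] ltkA] //=.
case: (set_0Vmem [set z in A | k < deg_in A z]) => [-> | [z]].
  by rewrite cards0.
rewrite inE => /andP[Az ltk] _; apply: leq_trans ltk _.
rewrite [#|A|](cardsD1 z) Az /=; apply/subset_leq_card/subsetP => x.
rewrite !inE => /andP[-> zx]; rewrite andbT.
by apply: contraTneq zx => ->; rewrite adj_irrefl.
Qed.

Lemma largest_incl_ge (H : graph) (A B K : {set H}) (c : H -> nat) :
  B \subset K -> K \subset A -> {in K, forall z, #|K| <= c z} ->
  #|K| <= largest_incl A B c.
Proof.
move=> BK KA cK; have ltKA : #|K| < #|A|.+1 by rewrite ltnS subset_leq_card.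
have sK : K \subset [set z in A | #|K| <= c z].
  by apply/subsetP => z Kz; rewrite inE (subsetP KA) //= cK.
apply: (bigmax_sup (Ordinal ltKA)) => //=.
by rewrite (subset_trans BK sK) subset_leq_card.
Qed.

Lemma largest_incl_le (H : graph) (A B : {set H}) (c : H -> nat) (y : H) :
  y \in B -> largest_incl A B c <= c y.
Proof.
move=> By; apply/bigmax_leqP => p /andP[/subsetP/(_ y By)].
by rewrite inE => /andP[].
Qed.

Section Bounds.
Variable G : graph.
Local Notation W := (join_vertex G).
Local Notation u := (apex G).

Lemma accn_phase2_le (y : W) : accn_phase2 y <= #|closed_nbhd y|.
Proof. by apply/largest_deg_lt/card_gt0P; exists y; apply: mem_closed_nbhd. Qed.

Lemma accn_phase3_le (s : seq W) (z : W) :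
  accn_phase3 s z <= accn_phase2 z.
Proof.
rewrite /accn_phase3; elim: filter (@accn_phase2 G) => //= y r IHr c.
apply: leq_trans (IHr _) _; rewrite /accn_update; case: eqP => // ->.
by apply: largest_incl_le; rewrite set21.
Qed.

(** The invariant of the in-place loop: when [y] in [K] is updated, the whole
    of [K], which contains the required vertices [y] and the apex, still has
    values at least [#|K|]. *)
Lemma accn_phase3_ge (s : seq W) (K : {set W}) :
  clique K -> u \in K -> {in K, forall z, #|K| <= accn_phase3 s z}.
Proof.
move=> cK Ku; rewrite /accn_phase3.
have: {in K, forall z, #|K| <= accn_phase2 z}.
  move=> z Kz; have := largest_deg_clique _ _ _ cK (clique_sub_closed_nbhd _ _ _ cK Kz).
  by rewrite -ltnS; apply: leq_trans; apply: leqSpred.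
elim: filter (@accn_phase2 G) => //= y r IHr c cge.
apply: IHr => z Kz; rewrite /accn_update; case: eqP => [zy | _]; last exact: cge.
rewrite -zy; apply: largest_incl_ge; last exact: cge.
  by rewrite subUset !sub1set Kz Ku.
exact: clique_sub_closed_nbhd.
Qed.

Lemma omega_le_ACCN (s : seq W) : omega W <= ACCN s.
Proof.
apply/bigmax_leqP => A /clique_apex cA.
apply: leq_trans (subset_leq_card (subsetUr [set u] A)) _.
apply: largest_incl_ge; [exact: subsetUl | exact: subsetT |].
by apply: accn_phase3_ge => //; apply: setU11.
Qed.

(** The neighbours of [x] in [G] avoid the independent set [I], so they all lie
    in the clique [K]. *)
Lemma closed_nbhd_clique (K I : {set G}) (x : G) :
  K :|: I = [set: G] -> clique K -> independent I -> x \in I ->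
  clique (closed_nbhd (Some x : W)).
Proof.
move=> KI /cliqueP cK /forall_inP/(_ x) iI Ix.
have {iI} nbK z : adj x z -> z \in K.
  move=> xz; have: z \in K :|: I by rewrite KI inE.
  rewrite inE => /orP[// | Iz].
  by move/forall_inP/(_ z Iz): (iI Ix); rewrite xz.
apply/cliqueP => -[a|] [b|] //; rewrite !inE /= !(inj_eq (@Some_inj _)).
case/predU1P=> [-> | xa] /predU1P[-> | xb] //.
- by rewrite eqxx.
- by rewrite adj_sym.
- by apply: cK; apply: nbK.
Qed.

End Bounds.

Theorem corollary5p3 (G : graph) (s : seq (join_vertex G)) :
  split_graph G ->
  perm_eq s (enum (join_vertex G)) ->
  ACCN s = omega (join_vertex G).
Proof.
move=> [K [I [KI _ cK iI]]] _.
apply/eqP; rewrite eqn_leq omega_le_ACCN andbT.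
apply/bigmax_leqP => p /andP[_ lep]; rewrite leqNgt; apply/negP => ltp.
pose M : {set join_vertex G} := apex G |: [set Some x | x in K].
have cM : clique M.
  apply: clique_apex; apply/cliqueP => _ _ /imsetP[x Kx ->] /imsetP[y Ky ->] /= xy.
  by move/cliqueP: cK; apply=> //; apply: contraNneq xy => ->.
suff sM : [set z in [set: join_vertex G] | p <= accn_phase3 s z] \subset M.
  have := leq_trans lep (leq_trans (subset_leq_card sM) (clique_le_omega _ _ cM)).
  by rewrite leqNgt ltp.
apply/subsetP => -[x|]; rewrite !inE //= => lepx.
apply/imset_f; have: x \in K :|: I by rewrite KI inE.
rewrite inE => /orP[// | Ix].
have := clique_le_omega _ _ (closed_nbhd_clique _ _ _ _ KI cK iI Ix).
rewrite leqNgt (leq_trans ltp) //.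
by rewrite (leq_trans lepx) // (leq_trans (accn_phase3_le _ _ _)) ?accn_phase2_le.
Qed.
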